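(* Let $d\ge 3$ and $\mathcal K=\{\beta\in\mathrm{Aut}(\mathbb Z^{d-1}):K^\beta=K\}$. Then: \begin{enumerate} \item If $d>3$ and $q=d-1$ is prime, then $\mathcal K\cong\mathbb Z_{d-1}$. Furthermore, if $l_i=i-1$ for $1\le i\le d-1$, then $\mathcal K$ is generated by the permutation $\beta$ with matrix $(b_{i,j})$ where $b_{i+1,i}=1$ for $1\le i\le d-2$, $b_{1,d-1}=1$, and all other entries are $0$. \item If $d=3$, $q>2$ and $l_2\in\{\pm1\}$, then $\mathcal K\cong\mathbb Z_2$. If $l_2=-1$, then $\mathcal K$ is generated by $\begin{pmatrix}1&0\\-1&-1\end{pmatrix}$, whereas if $l_2=1$, then $\mathcal K$ is generated by $\begin{pmatrix}-1&-1\\0&1\end{pmatrix}$. \item If $d=3$ and $q=2$, then $\mathcal K\cong D_3$, the dihedral group of order $6$. In this case, $\mathcal K$ consists of the identity, the two matrices $\begin{pmatrix}1&0\\-1&-1\end{pmatrix}$ and $\begin{pmatrix}-1&-1\\0&1\end{pmatrix}$, and the matrices $\begin{pmatrix}-1&-1\\1&0\end{pmatrix}$, $\begin{pmatrix}0&1\\-1&-1\end{pmatrix}$ and $\begin{pmatrix}0&1\\1&0\end{pmatrix}$. \item In all other cases, $\mathcal K$ is trivial. \end{enumerate}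
   Context: Let $d\ge 2$ and $q\ge 2$ be integers such that $d\le p+1$ for every prime $p$ dividing $q$, and write $\mathbb Z_q=\mathbb Z/q\mathbb Z$ (and similarly $\mathbb Z_n$ for the cyclic group of order $n$). Fix $l_1=0$ and $l_2,\dots,l_{d-1}\in\mathbb Z_q$ such that $l_i-l_j$ is invertible in $\mathbb Z_q$ whenever $i\ne j$. Let $\mathcal R_d(\mathbb Z_q)=\mathbb Z_q[t,(t+l_1)^{-1},\dots,(t+l_{d-1})^{-1}]$ (the localization of $\mathbb Z_q[t]$ at the elements $t+l_i$). Let $\bigoplus_{\mathbb Z^{d-1}}\mathbb Z_q$ have generators $1_{\mathbf x}$ ($\mathbf x\in\mathbb Z^{d-1}$) and ring structure $1_{\mathbf v}1_{\mathbf w}=1_{\mathbf v+\mathbf w}$. Let $K$ be the kernel of the surjective ring homomorphism $\bigoplus_{\mathbb Z^{d-1}}\mathbb Z_q\to\mathcal R_d(\mathbb Z_q)$, $1_{\mathbf x}\mapsto\prod_i(t+l_i)^{x_i}$. The group $\mathrm{Aut}(\mathbb Z^{d-1})$ acts on $\bigoplus_{\mathbb Z^{d-1}}\mathbb Z_q$ by ring automorphisms via $1_{\mathbf v}^{\beta}=1_{\beta(\mathbf v)}$ (extended additively), and $K^\beta$ denotes the image of $K$ under $\beta$. An automorphism $\beta\in\mathrm{Aut}(\mathbb Z^{d-1})$ is identified with its integer matrix $(b_{i,j})$ with respect to the standard basis, i.e. $\beta(\mathbf e_j)=\sum_k b_{k,j}\mathbf e_k$ (columns are images of basis vectors). *)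

(* Defs.v *)
From HB Require Import structures.
From mathcomp Require Import all_boot all_order all_algebra all_fingroup.
From mathcomp Require Import all_solvable ring.
From mathcomp Require Import generic_quotient.
From mathcomp Require Import boolp classical_sets.
From mathcomp Require Import finmap monalg.

Set Implicit Arguments.
Unset Strict Implicit.
Unset Printing Implicit Defensive.

Import GRing.Theory.

Local Open Scope ring_scope.
Local Open Scope quotient_scope.
Local Open Scope classical_set_scope.

(* Localization of a commutative ring at a multiplicative set: pairs (a, s)   *)
(* with s in S, where (a, s) ~ (b, t) iff u (a t - b s) = 0 for some u in S.  *)

Record mulset (R : comNzRingType) := Mulset {
  mulset_pred :> {pred R};
  mulset1 : 1 \in mulset_pred;
  mulsetM : {in mulset_pred &, forall s t, s * t \in mulset_pred};
  mulset0 : 0 \notin mulset_pred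
}.

Section Localization.
Variables (R : comNzRingType) (S : mulset R).

Definition loc_ratio := {x : R * R | x.2 \in S}.

HB.instance Definition _ := Choice.on loc_ratio.

Definition loc_num (x : loc_ratio) : R := (val x).1.
Definition loc_den (x : loc_ratio) : R := (val x).2.

Lemma loc_denP x : loc_den x \in S. Proof. exact: (valP x). Qed.

Definition loc_mkratio (a s : R) (Ss : s \in S) : loc_ratio :=
  exist _ (a, s) Ss.

Definition loc_ratio_eq (x y : loc_ratio) : bool :=
  `[< exists2 u, u \in S &
      u * (loc_num x * loc_den y - loc_num y * loc_den x) = 0 >].

Lemma loc_ratio_eq_refl : reflexive loc_ratio_eq.
Proof.
by move=> x; apply/asboolP; exists 1; [exact: mulset1 | rewrite subrr mulr0].
Qed.

Lemma loc_ratio_eq_sym : symmetric loc_ratio_eq.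
Proof.
move=> x y; apply/asboolP/asboolP => -[u Su h]; exists u => //;
  by rewrite -opprB mulrN h oppr0.
Qed.

Lemma loc_ratio_eq_trans : transitive loc_ratio_eq.
Proof.
move=> y x z /asboolP[u Su h] /asboolP[v Sv k]; apply/asboolP.
exists (u * v * loc_den y); first by rewrite !mulsetM ?loc_denP.
transitivity (v * loc_den z *
                (u * (loc_num x * loc_den y - loc_num y * loc_den x)) +
              u * loc_den x * (v * (loc_num y * loc_den z - loc_num z * loc_den y)));
  first by ring.
by rewrite h k !mulr0 addr0.
Qed.

Canonical loc_ratio_equiv :=
  EquivRel loc_ratio_eq loc_ratio_eq_refl loc_ratio_eq_sym loc_ratio_eq_trans.

Definition localization := {eq_quot loc_ratio_eq}.

HB.instance Definition _ : EqQuotient _ loc_ratio_eq localization :=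
  EqQuotient.on localization.
HB.instance Definition _ := Choice.on localization.

Definition loc_frac (a s : R) (Ss : s \in S) : localization :=
  \pi_localization (loc_mkratio a Ss).

Lemma loc_fracP (x : localization) :
  exists a s (Ss : s \in S), x = loc_frac a Ss.
Proof.
by elim/quotW: x => -[[a s] Ss]; exists a, s, Ss.
Qed.

Lemma loc_frac_eq a s (Ss : s \in S) b t (St : t \in S) :
  loc_frac a Ss = loc_frac b St <->
    exists2 u, u \in S & u * (a * t - b * s) = 0.
Proof. by split=> [/eqmodP/asboolP //|h]; apply/eqmodP/asboolP. Qed.

Definition loc_addq (x y : loc_ratio) : loc_ratio :=
  loc_mkratio (loc_num x * loc_den y + loc_num y * loc_den x)
    (mulsetM (loc_denP x) (loc_denP y)).
Definition loc_oppq (x : loc_ratio) : loc_ratio :=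
  loc_mkratio (- loc_num x) (loc_denP x).
Definition loc_mulq (x y : loc_ratio) : loc_ratio :=
  loc_mkratio (loc_num x * loc_num y) (mulsetM (loc_denP x) (loc_denP y)).

Definition loc_zero : localization := loc_frac 0 (mulset1 S).
Definition loc_one : localization := loc_frac 1 (mulset1 S).
Definition loc_add (x y : localization) : localization :=
  \pi_localization (loc_addq (repr x) (repr y)).
Definition loc_opp (x : localization) : localization :=
  \pi_localization (loc_oppq (repr x)).
Definition loc_mul (x y : localization) : localization :=
  \pi_localization (loc_mulq (repr x) (repr y)).

Lemma loc_reprP a s (Ss : s \in S) : exists2 u, u \in S &
  u * (loc_num (repr (loc_frac a Ss)) * s -
       a * loc_den (repr (loc_frac a Ss))) = 0.
Proof.
have /eqmodP/asboolP[u Su h] :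
    repr (loc_frac a Ss) = loc_mkratio a Ss %[mod localization].
  by rewrite reprK.
by exists u.
Qed.

Lemma loc_addE a s (Ss : s \in S) b t (St : t \in S) :
  loc_add (loc_frac a Ss) (loc_frac b St) =
  loc_frac (a * t + b * s) (mulsetM Ss St).
Proof.
rewrite /loc_add;
have [u Su h] := loc_reprP a Ss; have [v Sv k] := loc_reprP b St.
move: (repr (loc_frac a Ss)) (repr (loc_frac b St)) h k => x y h k.
apply/eqmodP/asboolP; exists (u * v); first exact: mulsetM.
rewrite /loc_addq /loc_num /loc_den /= -/(loc_num x) -/(loc_num y)
  -/(loc_den x) -/(loc_den y).
transitivity (v * t * loc_den y * (u * (loc_num x * s - a * loc_den x)) +
              u * s * loc_den x * (v * (loc_num y * t - b * loc_den y)));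
  first by ring.
by rewrite h k !mulr0 addr0.
Qed.

Lemma loc_oppE a s (Ss : s \in S) : loc_opp (loc_frac a Ss) = loc_frac (- a) Ss.
Proof.
rewrite /loc_opp; have [u Su h] := loc_reprP a Ss.
move: (repr (loc_frac a Ss)) h => x h.
apply/eqmodP/asboolP; exists u => //.
rewrite /loc_oppq /loc_num /loc_den /= -/(loc_num x) -/(loc_den x).
transitivity (- (u * (loc_num x * s - a * loc_den x)));
  first by ring.
by rewrite h oppr0.
Qed.

Lemma loc_mulE a s (Ss : s \in S) b t (St : t \in S) :
  loc_mul (loc_frac a Ss) (loc_frac b St) =
  loc_frac (a * b) (mulsetM Ss St).
Proof.
rewrite /loc_mul;
have [u Su h] := loc_reprP a Ss; have [v Sv k] := loc_reprP b St.
move: (repr (loc_frac a Ss)) (repr (loc_frac b St)) h k => x y h k.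
apply/eqmodP/asboolP; exists (u * v); first exact: mulsetM.
rewrite /loc_mulq /loc_num /loc_den /= -/(loc_num x) -/(loc_num y)
  -/(loc_den x) -/(loc_den y).
transitivity (v * loc_num y * t * (u * (loc_num x * s - a * loc_den x)) +
              u * a * loc_den x * (v * (loc_num y * t - b * loc_den y)));
  first by ring.
by rewrite h k !mulr0 addr0.
Qed.

Lemma loc_frac_eqW a s (Ss : s \in S) b t (St : t \in S) :
  a * t = b * s -> loc_frac a Ss = loc_frac b St.
Proof.
move=> h; apply/loc_frac_eq; exists 1; first exact: mulset1.
by rewrite h subrr mulr0.
Qed.

Lemma loc_addA : associative loc_add.
Proof.
move=> x y z; have [a [s [Ss ->]]] := loc_fracP x;
have [b [t [St ->]]] := loc_fracP y.
by have [c [r [Sr ->]]] := loc_fracP z; rewrite !loc_addE;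
  apply: loc_frac_eqW; ring.
Qed.

Lemma loc_addC : commutative loc_add.
Proof.
move=> x y; have [a [s [Ss ->]]] := loc_fracP x;
have [b [t [St ->]]] := loc_fracP y.
by rewrite !loc_addE;
  apply: loc_frac_eqW; ring.
Qed.

Lemma loc_add0 : left_id loc_zero loc_add.
Proof.
move=> x; have [a [s [Ss ->]]] := loc_fracP x.
by rewrite loc_addE;
  apply: loc_frac_eqW; ring.
Qed.

Lemma loc_addN : left_inverse loc_zero loc_opp loc_add.
Proof.
move=> x; have [a [s [Ss ->]]] := loc_fracP x.
by rewrite loc_oppE loc_addE;
  apply: loc_frac_eqW; ring.
Qed.

HB.instance Definition _ :=
  GRing.isZmodule.Build localization loc_addA loc_addC loc_add0 loc_addN.

Lemma loc_mulA : associative loc_mul.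
Proof.
move=> x y z; have [a [s [Ss ->]]] := loc_fracP x;
have [b [t [St ->]]] := loc_fracP y.
by have [c [r [Sr ->]]] := loc_fracP z; rewrite !loc_mulE;
  apply: loc_frac_eqW; ring.
Qed.

Lemma loc_mulC : commutative loc_mul.
Proof.
move=> x y; have [a [s [Ss ->]]] := loc_fracP x;
have [b [t [St ->]]] := loc_fracP y.
by rewrite !loc_mulE;
  apply: loc_frac_eqW; ring.
Qed.

Lemma loc_mul1 : left_id loc_one loc_mul.
Proof.
move=> x; have [a [s [Ss ->]]] := loc_fracP x.
by rewrite loc_mulE;
  apply: loc_frac_eqW; ring.
Qed.

Lemma loc_mulDl : left_distributive loc_mul loc_add.
Proof.
move=> x y z; have [a [s [Ss ->]]] := loc_fracP x;
have [b [t [St ->]]] := loc_fracP y.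
by have [c [r [Sr ->]]] := loc_fracP z; rewrite !(loc_mulE, loc_addE);
  apply: loc_frac_eqW; ring.
Qed.

Lemma loc_one_neq0 : loc_one != loc_zero.
Proof.
apply/eqP => /loc_frac_eq[u Su]; rewrite mul0r subr0 !mulr1 => u0.
by move: Su; rewrite u0 (negbTE (mulset0 S)).
Qed.

HB.instance Definition _ :=
  GRing.Zmodule_isComNzRing.Build localization loc_mulA loc_mulC loc_mul1
    loc_mulDl loc_one_neq0.

Definition loc_unit : {pred localization} :=
  fun x => `[< exists y : localization, y * x = 1 >].

Definition loc_inv (x : localization) : localization :=
  if pselect (exists y : localization, y * x = 1) is left h
  then projT1 (cid h) else x.

Lemma loc_mulVx : {in loc_unit, left_inverse 1 loc_inv *%R}.
Proof.
move=> x /asboolP ux; rewrite /loc_inv; case: pselect => // h.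
exact: projT2 (cid h).
Qed.

Lemma loc_unitPl (x y : localization) : y * x = 1 -> loc_unit x.
Proof. by move=> h; apply/asboolP; exists y. Qed.

Lemma loc_inv_out : {in [predC loc_unit], loc_inv =1 id}.
Proof.
by move=> x /asboolPn nx; rewrite /loc_inv; case: pselect => // h; case: nx.
Qed.

HB.instance Definition _ :=
  GRing.ComNzRing_hasMulInverse.Build localization
    loc_mulVx loc_unitPl loc_inv_out.

Definition to_loc (a : R) : localization := loc_frac a (mulset1 S).

Lemma to_loc_zmod_morphism : zmod_morphism to_loc.
Proof.
move=> a b; rewrite /to_loc -[RHS]/(loc_add _ (loc_opp _)) loc_oppE loc_addE.
by apply: loc_frac_eqW; ring.
Qed.

Lemma to_loc_monoid_morphism : monoid_morphism to_loc.
Proof.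
split=> [//|a b]; rewrite /to_loc -[RHS]/(loc_mul _ _) loc_mulE.
by apply: loc_frac_eqW; ring.
Qed.

HB.instance Definition _ :=
  GRing.isZmodMorphism.Build R localization to_loc to_loc_zmod_morphism.
HB.instance Definition _ :=
  GRing.isMonoidMorphism.Build R localization to_loc to_loc_monoid_morphism.

Lemma to_loc_unit s : s \in S -> to_loc s \is a GRing.unit.
Proof.
move=> Ss; apply/unitrP; exists (loc_frac 1 Ss).
suff h : loc_frac 1 Ss * to_loc s = 1 by rewrite [to_loc s * _]mulrC.
by rewrite -[LHS]/(loc_mul _ _) loc_mulE;
  apply: loc_frac_eqW; ring.
Qed.

Lemma loc_fracE a s (Ss : s \in S) : loc_frac a Ss = to_loc a / to_loc s.
Proof.
apply: (mulIr (to_loc_unit Ss)); rewrite divrK ?to_loc_unit //.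
by rewrite -[LHS]/(loc_mul _ _) loc_mulE;
  apply: loc_frac_eqW; ring.
Qed.

End Localization.

(* The group algebra R[V] of an abelian group V, whose basis element at v is  *)
(* << v >>. The ring structure of {malg R[V]} cannot be reused: it requires   *)
(* a monoid without nontrivial units.                                         *)

Definition grpalg (R : comNzRingType) (V : zmodType) := {malg R[V]}.

Section GrpAlg.
Variables (R : comNzRingType) (V : zmodType).
Implicit Types f g : {malg R[V]}.

HB.instance Definition _ := GRing.Zmodule.on (grpalg R V).

Definition grpalg_one : {malg R[V]} := << 0 >>.
Definition grpalg_mul f g : {malg R[V]} :=
  \sum_(v <- msupp f) \sum_(w <- msupp g) << f@_v * g@_w *g v + w >>.

Lemma grpalg_mulw (d1 d2 : {fset V}) f g :
  (msupp f `<=` d1)%fset -> (msupp g `<=` d2)%fset ->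
  grpalg_mul f g = \sum_(v <- d1) \sum_(w <- d2) << f@_v * g@_w *g v + w >>.
Proof.
move=> le_d1 le_d2; rewrite /grpalg_mul (big_fset_incl _ le_d1) /=.
  apply/eq_bigr=> v _; apply/big_fset_incl => // w _ /mcoeff_outdom ->.
  by rewrite mulr0 monalgU0.
move=> v _ /mcoeff_outdom fv.
by rewrite big1 // => w _; rewrite fv mul0r monalgU0.
Qed.

Lemma grpalg_mulC : commutative grpalg_mul.
Proof.
move=> f g; rewrite /grpalg_mul exchange_big; apply/eq_bigr=> v _.
by apply/eq_bigr=> w _; rewrite mulrC addrC.
Qed.

Lemma grpalg_mul0 : left_zero 0 grpalg_mul.
Proof. by move=> g; rewrite /grpalg_mul msupp0 big_seq_fset0. Qed.

Lemma grpalg_mulDl : left_distributive grpalg_mul +%R.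
Proof.
move=> f1 f2 g.
rewrite (grpalg_mulw (msuppD_le _ _) (fsubset_refl _)).
rewrite (grpalg_mulw (fsubsetUl _ (msupp f2)) (fsubset_refl (msupp g))).
rewrite (grpalg_mulw (fsubsetUr (msupp f1) _) (fsubset_refl (msupp g))).
rewrite -big_split /=; apply/eq_bigr=> v _.
rewrite -big_split /=; apply/eq_bigr=> w _.
by rewrite mcoeffD mulrDl monalgUD.
Qed.

Lemma grpalg_mulDr : right_distributive grpalg_mul +%R.
Proof. by move=> f g h; rewrite !(grpalg_mulC f) grpalg_mulDl. Qed.

Lemma grpalg_mulUU a b v w :
  grpalg_mul << a *g v >> << b *g w >> = << a * b *g v + w >>.
Proof.
by rewrite (grpalg_mulw msuppU_le msuppU_le) !big_seq_fset1 !mcoeffUU.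
Qed.

Lemma grpalg_mul_suml (I : Type) (s : seq I) (F : I -> {malg R[V]}) g :
  grpalg_mul (\sum_(i <- s) F i) g = \sum_(i <- s) grpalg_mul (F i) g.
Proof.
exact: (big_morph (grpalg_mul^~ g) (fun x y => grpalg_mulDl x y g)
  (grpalg_mul0 g)).
Qed.

Lemma grpalg_mul_sumr (I : Type) (s : seq I) (F : I -> {malg R[V]}) g :
  grpalg_mul g (\sum_(i <- s) F i) = \sum_(i <- s) grpalg_mul g (F i).
Proof.
rewrite grpalg_mulC grpalg_mul_suml.
by apply: eq_bigr => i _; rewrite grpalg_mulC.
Qed.

Lemma grpalg_mulA : associative grpalg_mul.
Proof.
move=> f g h; rewrite [f]monalgE.
elim/big_ind: _ => [|f1 f2 h1 h2|u _];
  rewrite ?grpalg_mul0 ?grpalg_mulDl ?h1 ?h2 //.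
rewrite [g]monalgE; elim/big_ind: _ => [|g1 g2 h1 h2|v _].
- by rewrite [grpalg_mul _ 0]grpalg_mulC !grpalg_mul0
    [grpalg_mul _ 0]grpalg_mulC !grpalg_mul0.
- by rewrite !(grpalg_mulDl, grpalg_mulDr) h1 h2.
rewrite [h]monalgE; elim/big_ind: _ => [|g1 g2 h1 h2|w _].
- by rewrite ![grpalg_mul _ 0]grpalg_mulC !grpalg_mul0
    [grpalg_mul _ 0]grpalg_mulC grpalg_mul0.
- by rewrite !(grpalg_mulDl, grpalg_mulDr) h1 h2.
by rewrite !grpalg_mulUU mulrA addrA.
Qed.

Lemma grpalg_mul1 : left_id grpalg_one grpalg_mul.
Proof.
move=> g; rewrite [in LHS](monalgE g) grpalg_mul_sumr [RHS]monalgE.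
by apply: eq_bigr => v _; rewrite grpalg_mulUU mul1r add0r.
Qed.

Lemma grpalg_one_neq0 : grpalg_one != 0.
Proof. by rewrite monalgU_eq0 oner_eq0. Qed.

HB.instance Definition _ :=
  GRing.Zmodule_isComNzRing.Build (grpalg R V)
    grpalg_mulA grpalg_mulC grpalg_mul1
    grpalg_mulDl grpalg_one_neq0.

End GrpAlg.

(* The automorphisms of Z^n are the invertible integer matrices, acting on    *)
(* column vectors: B *m e_j is the j-th column of B.                          *)
Definition grpalg_act (R : comNzRingType) (n : nat) (B : 'M[int]_n)
    (f : grpalg R 'cV[int]_n) : grpalg R 'cV[int]_n :=
  \sum_(v <- msupp f) << f@_v *g B *m v >>.

Section GrpAlgTheory.
Variables (R : comNzRingType) (V : zmodType).

(* Every function on R[V] that is additive and multiplicative on the basis is *)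
(* a ring morphism.                                                           *)
Lemma grpalg_lift_zmod_morphism (A : comNzRingType) (F : R -> V -> A) :
    (forall v, zmod_morphism (F^~ v)) ->
  zmod_morphism (fun f : grpalg R V => \sum_(v <- msupp f) F f@_v v).
Proof.
move=> Fzmod; have F0 v : F 0 v = 0 by rewrite -(subrr 0) Fzmod subrr.
have Ew (f : grpalg R V) (E : {fset V}) : (msupp f `<=` E)%fset ->
    \sum_(v <- msupp f) F f@_v v = \sum_(v <- E) F f@_v v.
  move=> fE; rewrite [LHS](big_fset_incl _ fE) // => v _ /mcoeff_outdom ->.
  exact: F0.
move=> f g; set E := (msupp f `|` msupp g)%fset.
rewrite (Ew f E) ?fsubsetUl // (Ew g E) ?fsubsetUr // (Ew (f - g) E).
  by rewrite -sumrB; apply: eq_bigr => v _; rewrite mcoeffB Fzmod.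
exact: msuppB_le.
Qed.

Lemma grpalg_lift_monoid_morphism (A : comNzRingType) (F : R -> V -> A) :
    (forall v, zmod_morphism (F^~ v)) -> F 1 0 = 1 ->
    (forall a b v w, F (a * b) (v + w) = F a v * F b w) ->
  monoid_morphism (fun f : grpalg R V => \sum_(v <- msupp f) F f@_v v).
Proof.
move=> Fzmod F1 FM; set ev := fun f => _.
have F0 v : F 0 v = 0 by rewrite -(subrr 0) Fzmod subrr.
have evB := grpalg_lift_zmod_morphism Fzmod; rewrite -/ev in evB.
have evU a v : ev << a *g v >> = F a v.
  rewrite /ev msuppU; have [->|_] := eqVneq a 0.
    by rewrite big_seq_fset0 F0.
  by rewrite big_seq_fset1 mcoeffUU.
have ev0 : ev 0 = 0 by rewrite -(subrr 0) evB subrr.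
have evD f g : ev (f + g) = ev f + ev g.
  by rewrite -[g in LHS]opprK evB -[- g]sub0r evB ev0 sub0r opprK.
have evS := big_morph ev evD ev0.
split=> [|f g]; first by rewrite -[1]/(<< 1 *g 0 >>) evU.
rewrite -[f * g]/(grpalg_mul f g) /grpalg_mul evS [ev f]/ev mulr_suml.
apply: eq_bigr => v _; rewrite evS [ev g]/ev mulr_sumr.
by apply: eq_bigr => w _; rewrite evU FM.
Qed.

End GrpAlgTheory.

Section GrpAlgAct.
Variables (R : comNzRingType) (n : nat) (B : 'M[int]_n).

Fact grpalg_act_zmod_morphism : zmod_morphism (@grpalg_act R n B).
Proof.
apply: (@grpalg_lift_zmod_morphism R 'cV_n (grpalg R 'cV_n)
  (fun a v => << a *g B *m v >>)).
by move=> v a b; rewrite monalgUB.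
Qed.

Fact grpalg_act_monoid_morphism : monoid_morphism (@grpalg_act R n B).
Proof.
apply: (@grpalg_lift_monoid_morphism R 'cV_n (grpalg R 'cV_n)
  (fun a v => << a *g B *m v >>)).
- by move=> v a b; rewrite monalgUB.
- by rewrite mulmx0.
- by move=> a b v w; rewrite mulmxDr -grpalg_mulUU.
Qed.

Lemma grpalg_actU (a : R) v :
  grpalg_act B << a *g v >> = << a *g B *m v >> :> grpalg R 'cV_n.
Proof.
rewrite /grpalg_act msuppU; have [->|_] := eqVneq a 0.
  by rewrite big_seq_fset0 monalgU0.
by rewrite big_seq_fset1 mcoeffUU.
Qed.

End GrpAlgAct.

HB.instance Definition _ (R : comNzRingType) (n : nat) (B : 'M[int]_n) :=
  GRing.isZmodMorphism.Build (grpalg R 'cV_n) (grpalg R 'cV_n) (grpalg_act B)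
    (@grpalg_act_zmod_morphism R n B).
HB.instance Definition _ (R : comNzRingType) (n : nat) (B : 'M[int]_n) :=
  GRing.isMonoidMorphism.Build (grpalg R 'cV_n) (grpalg R 'cV_n) (grpalg_act B)
    (@grpalg_act_monoid_morphism R n B).

Section Kernel.

(* l is indexed from 1: only l 1, ..., l d.-1 are relevant, and the ordinal   *)
(* i : 'I_d.-1 stands for the index i.+1. 'Z_q is Z/q only when q >= 2.       *)
Variables (d q : nat) (l : nat -> 'Z_q).

Definition tshift (i : 'I_d.-1) : {poly 'Z_q} := 'X + (l i.+1)%:P.

Definition denoms : {pred {poly 'Z_q}} :=
  fun p => `[< exists e : 'I_d.-1 -> nat, p = \prod_i tshift i ^+ e i >].

Lemma denoms1 : 1 \in denoms.
Proof.
by apply/asboolP; exists (fun=> 0%N); rewrite big1 // => i _; rewrite expr0.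
Qed.

Lemma denomsM : {in denoms &, forall s t, s * t \in denoms}.
Proof.
move=> _ _ /asboolP[e ->] /asboolP[f ->]; apply/asboolP.
exists (fun i => (e i + f i)%N); rewrite -big_split /=.
by apply: eq_bigr => i _; rewrite exprD.
Qed.

Lemma denoms_neq0 : 0 \notin denoms.
Proof.
apply/asboolPn => -[e e0].
have : \prod_i tshift i ^+ e i \is monic.
  by apply: monic_prod => i _; apply: monic_exp; apply: monicXaddC.
by rewrite -e0 monicE lead_coef0 eq_sym oner_eq0.
Qed.

Definition denoms_mulset : mulset {poly 'Z_q} :=
  Mulset denoms1 denomsM denoms_neq0.

Definition Rd : comUnitRingType := localization denoms_mulset.

Definition tmonomial (x : 'cV[int]_d.-1) : Rd :=
  \prod_i (to_loc denoms_mulset (tshift i)) ^ (x i ord0).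

Definition Rd_eval (f : grpalg 'Z_q 'cV[int]_d.-1) : Rd :=
  \sum_(v <- msupp f) to_loc denoms_mulset (f@_v)%:P * tmonomial v.

Lemma tshift_unit i : to_loc denoms_mulset (tshift i) \is a GRing.unit.
Proof.
apply: to_loc_unit; apply/asboolP; exists (fun j => (j == i) : nat).
rewrite (bigD1 i) //= eqxx expr1 big1 ?mulr1 // => j /negPf ->.
by rewrite expr0.
Qed.

Lemma tmonomial0 : tmonomial 0 = 1.
Proof. by rewrite /tmonomial big1 // => i _; rewrite mxE expr0z. Qed.

Lemma tmonomialD x y : tmonomial (x + y) = tmonomial x * tmonomial y.
Proof.
rewrite -big_split; apply: eq_bigr => i _ /=.
by rewrite mxE exprzDr ?tshift_unit.
Qed.

Fact Rd_eval_zmod_morphism : zmod_morphism Rd_eval.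
Proof.
apply: (@grpalg_lift_zmod_morphism _ _ Rd
  (fun a v => to_loc denoms_mulset a%:P * tmonomial v)).
by move=> v a b; rewrite !rmorphB mulrBl.
Qed.

Fact Rd_eval_monoid_morphism : monoid_morphism Rd_eval.
Proof.
apply: (@grpalg_lift_monoid_morphism _ _ Rd
  (fun a v => to_loc denoms_mulset a%:P * tmonomial v)).
- by move=> v a b; rewrite !rmorphB mulrBl.
- by rewrite !rmorph1 mul1r tmonomial0.
- by move=> a b v w; rewrite !rmorphM tmonomialD mulrACA.
Qed.

HB.instance Definition _ := GRing.isZmodMorphism.Build
  (grpalg 'Z_q 'cV[int]_d.-1) Rd Rd_eval Rd_eval_zmod_morphism.
HB.instance Definition _ := GRing.isMonoidMorphism.Build
  (grpalg 'Z_q 'cV[int]_d.-1) Rd Rd_eval Rd_eval_monoid_morphism.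

Lemma Rd_evalU a x :
  Rd_eval << a *g x >> = to_loc denoms_mulset a%:P * tmonomial x.
Proof.
rewrite /Rd_eval msuppU; have [->|_] := eqVneq a 0.
  by rewrite big_seq_fset0 !rmorph0 mul0r.
by rewrite big_seq_fset1 mcoeffUU.
Qed.

Lemma Rd_eval1 x : Rd_eval << x >> = tmonomial x.
Proof. by rewrite Rd_evalU !rmorph1 mul1r. Qed.

Lemma Rd_eval_surj (y : Rd) : (1 < d)%N -> l 1 = 0 -> exists f, Rd_eval f = y.
Proof.
move=> d_gt1 l1; have n_gt0 : (0 < d.-1)%N by case: d d_gt1 => [|[]].
pose i0 := Ordinal n_gt0.
have [a [s [Ss ->]]] := loc_fracP y; rewrite loc_fracE.
have mon (e : 'I_d.-1 -> int) :
    tmonomial (\col_i e i) = \prod_i to_loc denoms_mulset (tshift i) ^ e i.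
  by apply: eq_bigr => i _; rewrite mxE.
have [f fa] : exists f, Rd_eval f = to_loc denoms_mulset a.
  elim/poly_ind: a => [|p c [f fp]]; first by exists 0; rewrite !rmorph0.
  exists (f * << \col_i ((i == i0) : nat)%:Z >> + << c *g 0 >>).
  rewrite rmorphD rmorphM /= fp Rd_eval1 Rd_evalU tmonomial0 mulr1 mon.
  have -> : \prod_i to_loc denoms_mulset (tshift i) ^ ((i == i0) : nat)%:Z =
            to_loc denoms_mulset 'X.
    rewrite (bigD1 i0) //= big1 ?mulr1; last first.
      by move=> i /negPf ->; rewrite expr0z.
    by rewrite expr1z /tshift /= l1 addr0.
  by rewrite rmorphD rmorphM.
have /asboolP[e se] := Ss.
exists (f * << \col_i - (e i)%:Z >>); rewrite rmorphM /= fa Rd_eval1 mon.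
congr (_ * _); rewrite [in RHS]se rmorph_prod -prodrV => [|i _].
  by apply: eq_bigr => i _; rewrite rmorphXn exprnN.
by rewrite rmorphXn unitrX ?tshift_unit.
Qed.

Definition Rd_ker : set (grpalg 'Z_q 'cV[int]_d.-1) :=
  [set f | Rd_eval f = 0].

Definition ker_stab : set 'M[int]_d.-1 :=
  [set B | B \in unitmx /\ grpalg_act B @` Rd_ker = Rd_ker].

End Kernel.

Arguments Rd_eval d {q} l f.
Arguments Rd_ker d {q} l.
Arguments ker_stab d {q} l.

(* The group law of a residue ring taken as a finGroupType is its addition.   *)
Definition mx_group_iso (gT : finGroupType) (n : nat) (P : set 'M[int]_n) :=
  exists f : gT -> 'M[int]_n,
    [/\ forall x y, f (x * y)%g = f x *m f y, injective f & range f = P].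

Definition mx_cycle (n : nat) (B : 'M[int]_n) : set 'M[int]_n :=
  [set C | exists k : nat, C = B ^+ k \/ C = invmx B ^+ k].

Definition mx_of_rows (n : nat) (s : seq (seq int)) : 'M[int]_n :=
  \matrix_(i, j) nth 0 (nth [::] s i) j.

(* Ones just below the diagonal and in the top right corner: e_j |-> e_(j+1), *)
(* cyclically.                                                                *)
Definition cyclic_shift_mx (n : nat) : 'M[int]_n :=
  \matrix_(i, j)
    ((i == j.+1 :> nat) || ((i == 0 :> nat) && (j == n.-1 :> nat)))%:R.

(* Main.v *)
Require Import Defs.
From mathcomp Require Import all_boot all_order all_algebra all_fingroup.
From mathcomp Require Import all_solvable ring zify.
From mathcomp Require Import boolp classical_sets.
From mathcomp Require Import finmap monalg.
Set Implicit Arguments.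
Unset Strict Implicit.
Unset Printing Implicit Defensive.
Import Order.TTheory GRing.Theory Num.Theory.
Local Open Scope ring_scope.
Local Open Scope classical_set_scope.

(** Write n = d - 1, m_j for the monomial whose exponents are the j-th column
    of B, and lambda_j for l_(j+1), so that lambda_0 = 0.

    The matrix B maps the kernel K into itself exactly when t + lambda_j |-> m_j
    comes from a Z_q-algebra endomorphism of R_d, that is, when
    m_j = m_i + (lambda_j - lambda_i) for all i and j ([ker_stab_rel],
    [rel_ker_sub]). Read m_j as N_j / D: the N_j = N_i + (lambda_j - lambda_i) D
    together with D are n + 1 products of powers of the n linear forms
    t + lambda_k. Any two of them span all the others, because the differences
    lambda_i - lambda_j are units; so, once common factors are removed, t +
    lambda_k divides at most one of them, as evaluation at t = - lambda_k shows
    ([row_sparse]). The evaluation takes place in Z_q, whose zero divisors do no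
    harm because the other forms take unit values there. Hence row k of B is a multiple of a basis row or of (-1, ..., -1),
    and invertibility of B makes the multiplier 1 and the rows distinct
    ([rel_row_form]). Now N_1, ..., N_n, D are, up to order, the n linear forms
    and the constant 1.

    If D = 1, the forms are permuted by a translation lambda |-> lambda + c
    ([form_trans]). A nonzero c is a difference of two lambdas, hence a unit,
    so the set of lambdas is all of Z_q and q = n ([trans_surj], [surj_card]);
    as n <= p for every prime p dividing q, this q is prime. The translations
    then form a cyclic group of order q ([full_iso], [full_cycle]).

    If N_i = 1, then t + lambda_k = 1 + (lambda_j - lambda_i) D for j <> i, and
    comparing leading coefficients gives lambda_j = lambda_i + 1 for all
    j <> i, so n = 2 ([form_none_small]). For n = 2 the six arrangements of
    {t, t + lambda_1, 1} are compared with the single remaining equation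
    ([rank2_sub], [rank2_super]); all six occur when q = 2, and they form the
    symmetric group on the rows (1, 0), (0, 1), (-1, -1)
    ([mx_group_iso_D6]). *)

(** * Kernel-preserving matrices and shifted monomials *)

Lemma to_loc_inj (R : comNzRingType) (S : mulset R) :
  {in S, forall s, GRing.lreg s} -> injective (to_loc S).
Proof.
move=> Sreg a b /loc_frac_eq[u Su]; rewrite !mulr1 => u0.
by apply/eqP; rewrite -subr_eq0; apply/eqP/(Sreg u Su); rewrite mulr0.
Qed.

Lemma expz_sum (R : comUnitRingType) (I : Type) (r : seq I) (F : I -> int)
    (x : R) : x \is a GRing.unit ->
  x ^ (\sum_(i <- r) F i) = \prod_(i <- r) x ^ F i.
Proof.
move=> ux; elim/big_rec2: _ => [|i y _ _ <-]; first by rewrite expr0z.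
by rewrite exprzDr.
Qed.

Lemma prod_expz (R : comUnitRingType) (I : finType) (F : I -> R) (a : int) :
    (forall i, F i \is a GRing.unit) ->
  (\prod_i F i) ^ a = \prod_i F i ^ a.
Proof.
move=> uF; have H (r : seq I) :
    (\prod_(i <- r) F i) ^ a = \prod_(i <- r) F i ^ a.
  elim: r => [|i r IHr]; first by rewrite !big_nil exp1rz.
  rewrite !big_cons exprMz_comm ?IHr //; last exact: mulrC.
  by rewrite big_seq; apply: rpred_prod => j _.
exact: H.
Qed.

Section Kernel.
Variables (d q : nat) (l : nat -> 'Z_q).
Local Notation loc := (to_loc (denoms_mulset d l)).
Local Notation X_ := (@tshift d q l).

Lemma denoms_lreg : {in denoms d l, forall s, GRing.lreg s}.
Proof.
move=> s /asboolP[e ->]; apply: monic_lreg.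
by apply: monic_prod => i _; apply: monic_exp; apply: monicXaddC.
Qed.

Lemma loc_inj : injective loc.
Proof. by apply: to_loc_inj => s; apply: denoms_lreg. Qed.

Lemma tmonomial_unit v : @tmonomial d q l v \is a GRing.unit.
Proof. by apply: rpred_prod => i _; rewrite unitrXz ?tshift_unit. Qed.

(** The exponents of a finitely supported [f] become nonnegative after one
    shift by [w], so up to a unit the value of [f] is that of a polynomial. *)
Lemma eval_clear_denominators (A : comUnitRingType) (phi : {rmorphism {poly 'Z_q} -> A})
    (f : grpalg 'Z_q 'cV[int]_d.-1) (w : 'cV[int]_d.-1) :
    (forall k, phi (X_ k) \is a GRing.unit) ->
    (forall v, v \in msupp f -> forall k, (0 <= (v + w) k 0)%R) ->
  (\sum_(v <- msupp f) phi (f@_v)%:P * \prod_k phi (X_ k) ^ v k ord0) *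
    (\prod_k phi (X_ k) ^ w k ord0) =
  phi (\sum_(v <- msupp f) (f@_v)%:P * \prod_k X_ k ^+ `|(v + w)%R k ord0|%N).
Proof.
move=> uphi w_ge; rewrite mulr_suml rmorph_sum; apply: eq_big_seq => v fv.
rewrite -mulrA -big_split rmorphM rmorph_prod; congr (_ * _).
apply: eq_bigr => k _; rewrite rmorphXn /=; have := exprzDr (uphi k).
by move=> <-; rewrite exprnP gez0_abs ?w_ge // mxE.
Qed.

(** The universal property of the localization, in the only form needed: an
    element killed by evaluation is killed by every ring morphism out of
    [{poly 'Z_q}] that inverts the shifts of t. After clearing denominators
    the polynomial at hand is itself zero, because [to_loc] is injective. *)
Lemma ker_universal (A : comUnitRingType) (phi : {rmorphism {poly 'Z_q} -> A})
    (f : grpalg 'Z_q 'cV[int]_d.-1) :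
    (forall k, phi (X_ k) \is a GRing.unit) -> Rd_eval d l f = 0 ->
  \sum_(v <- msupp f) phi (f@_v)%:P * \prod_k phi (X_ k) ^ v k ord0 = 0.
Proof.
move=> uphi f0.
pose w : 'cV[int]_d.-1 := \col_k (\sum_(v <- msupp f) `|v k ord0|%N)%:Z.
have w_ge v : v \in msupp f -> forall k, 0 <= (v + w) k 0.
  have absD (z : int) (m : nat) : 0 <= z + (`|z| + m)%N by lia.
  by move=> fv k; rewrite !mxE (big_fsetD1 v) //= absD.
set P := \sum_(v <- msupp f) (f@_v)%:P * \prod_k X_ k ^+ `|(v + w)%R k ord0|%N.
have P0 : P = 0.
  apply: loc_inj; rewrite rmorph0 -(eval_clear_denominators (phi := loc) _ w_ge) /=.
    by rewrite -[X in X * _]/(Rd_eval d l f) f0 mul0r.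
  by move=> k; apply: tshift_unit.
have := eval_clear_denominators uphi w_ge; rewrite -/P P0 rmorph0.
move/(congr1 (fun x => x / \prod_k phi (X_ k) ^ w k ord0)).
rewrite mul0r mulrK //.
by apply: rpred_prod => i _; rewrite unitrXz.
Qed.

(** The equations m_j = m_i + (l_j - l_i) between the monomials read off the
    columns of [B]: the images of the t + l_j differ by the same constants as
    the t + l_j themselves. *)
Definition translation_rel (B : 'M[int]_d.-1) := forall i j : 'I_d.-1,
  @tmonomial d q l (col j B) =
  tmonomial l (col i B) + loc (l j.+1 - l i.+1)%:P.

(** The kernel contains << e_j >> - << e_i >> - (l_j - l_i) << 0 >>, and the
    image of this element is the required equation. *)
Lemma ker_stab_rel B : ker_stab d l B -> translation_rel B.
Proof.
case=> _ stab i j.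
pose e k : 'cV[int]_d.-1 := delta_mx k 0.
pose f : grpalg 'Z_q 'cV[int]_d.-1 :=
   << e j >> - << e i >> - << (l j.+1 - l i.+1) *g 0 >>.
have te k : tmonomial l (e k) = loc (X_ k).
  rewrite /tmonomial (bigD1 k) //= big1 ?mulr1 => [|k' /negPf kk'].
    by rewrite mxE !eqxx expr1z.
  by rewrite mxE kk' expr0z.
have evf v w a : Rd_eval d l (<< v >> - << w >> - << a *g 0 >>) =
    tmonomial l v - tmonomial l w - loc a%:P.
  etransitivity; first exact: (rmorphB (Rd_eval d l)).
  congr (_ - _); last by etransitivity; [exact: Rd_evalU | rewrite tmonomial0 mulr1].
  etransitivity; first exact: (rmorphB (Rd_eval d l)).
  by congr (_ - _); exact: Rd_eval1.
have Kf : Rd_ker d l f.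
  rewrite /Rd_ker /= evf !te -(rmorph0 loc) -rmorphB -rmorphB.
  congr (loc _); rewrite /tshift polyCB; ring.
have : Rd_ker d l (grpalg_act B f) by rewrite -stab; exists f.
have actf : grpalg_act B f =
    << B *m e j >> - << B *m e i >> - << (l j.+1 - l i.+1) *g 0 >>.
  etransitivity; first exact: (rmorphB (grpalg_act B)).
  congr (_ - _); last by etransitivity; [exact: grpalg_actU | rewrite mulmx0].
  etransitivity; first exact: (rmorphB (grpalg_act B)).
  by congr (_ - _); exact: grpalg_actU.
rewrite /Rd_ker /= actf evf -!colE => h.
by apply: subr0_eq; rewrite opprD addrA.
Qed.

Lemma tmonomial_mulmx (B : 'M[int]_d.-1) v :
  tmonomial l (B *m v) = \prod_j tmonomial l (col j B) ^ v j ord0.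
Proof.
rewrite /tmonomial; transitivity (\prod_j \prod_i loc (X_ i) ^ (B i j * v j ord0)).
  rewrite exchange_big; apply: eq_bigr => i _; rewrite mxE expz_sum //.
  exact: tshift_unit.
apply: eq_bigr => j _; rewrite prod_expz => [|i]; last by rewrite unitrXz ?tshift_unit.
by apply: eq_bigr => i _; rewrite mxE exprz_exp.
Qed.

(** Apply the universal property to the morphism sending t to the monomial of
    the first column: by the relation it sends t + l_k to the k-th one. *)
Lemma rel_ker_sub B (n_gt0 : (0 < d.-1)%N) : l 1%N = 0 -> translation_rel B ->
  forall f, Rd_ker d l f -> Rd_ker d l (grpalg_act B f).
Proof.
move=> l1 Brel f f0; pose i0 := Ordinal n_gt0.
pose c : {rmorphism 'Z_q -> Rd d l} := loc \o polyC.
pose u := tmonomial l (col i0 B).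
have cu : commr_rmorph c u by move=> a; rewrite /GRing.comm mulrC.
pose phi : {rmorphism {poly 'Z_q} -> Rd d l} := horner_morph cu.
have phiX k : phi (X_ k) = tmonomial l (col k B).
  rewrite rmorphD /= horner_morphX horner_morphC (Brel i0 k) /=.
  by rewrite l1 subr0.
have uphi k : phi (X_ k) \is a GRing.unit by rewrite phiX tmonomial_unit.
have := ker_universal uphi f0; rewrite /Rd_ker /= /grpalg_act rmorph_sum /=.
move=> E; rewrite -[RHS]E; apply: eq_bigr => v _.
etransitivity; first exact: Rd_evalU.
rewrite tmonomial_mulmx.
apply: (f_equal2 *%R).
  by rewrite /= horner_morphC.
by apply: eq_bigr => k _; rewrite phiX.
Qed.

Lemma grpalg_actM (B B' : 'M[int]_d.-1) (f : grpalg 'Z_q 'cV[int]_d.-1) :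
  grpalg_act B (grpalg_act B' f) = grpalg_act (B *m B') f.
Proof.
rewrite [grpalg_act B' f]/grpalg_act rmorph_sum.
by apply: eq_bigr => v _; rewrite /= grpalg_actU mulmxA.
Qed.

Lemma grpalg_act1 (f : grpalg 'Z_q 'cV[int]_d.-1) : grpalg_act 1%:M f = f.
Proof.
rewrite [RHS](monalgE f); apply: eq_bigr => v _; by rewrite mul1mx.
Qed.

(** Inclusion of the image of the kernel in the kernel for both [B] and its
    inverse gives the equality of sets. *)
Lemma rel_ker_stab B B' : (0 < d.-1)%N -> l 1%N = 0 -> B *m B' = 1%:M ->
  translation_rel B -> translation_rel B' -> ker_stab d l B.
Proof.
move=> n_gt0 l1 BB' rB rB'; split; first by case: (mulmx1_unit BB').
apply/seteqP; split=> [_ [f Kf <-]|f Kf]; first exact: rel_ker_sub Kf.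
exists (grpalg_act B' f); first exact: rel_ker_sub Kf.
by rewrite grpalg_actM BB' grpalg_act1.
Qed.

End Kernel.

(** * Shape of the rows *)

Lemma int_mul_eq1 (a x : int) : 0 <= a -> a * x = 1 -> a = 1.
Proof.
move=> a_ge0 /(congr1 absz); rewrite abszM /= => /eqP; rewrite muln_eq1.
by case/andP=> /eqP a1 _; rewrite -(gez0_abs a_ge0) a1.
Qed.

(** Row [k] is the basis row of index [i] when [o k = Some i] and the constant
    row -1 when [o k = None]: [o k] tells which of the numerators N_i
    (or the common denominator, for [None]) contains the form t + l_k. *)
Definition row_form n (o : 'I_n -> option 'I_n) : 'M[int]_n :=
  \matrix_(k, j) if o k is Some i then (i == j)%:R else -1.

Section Relation.
Variables (d q : nat) (l : nat -> 'Z_q).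
Hypothesis l_unit : forall i j : 'I_d.-1, i != j ->
  l i.+1 - l j.+1 \is a GRing.unit.
Local Notation n := d.-1.
Local Notation loc := (to_loc (denoms_mulset d l)).
Local Notation X_ := (@tshift d q l).

(** Columns with one more index, [None], for the constant monomial 1. *)
Definition xcol (B : 'M[int]_n) (s : option 'I_n) : 'cV[int]_n :=
  if s is Some j then col j B else 0.

(** The monomials 1, m_1, ..., m_n multiplied by the monomial of exponent [e];
    taking absolute values does no harm when [e] is large enough. *)
Definition cleared (B : 'M[int]_n) (e : 'cV[int]_n) s : {poly 'Z_q} :=
  \prod_k X_ k ^+ `|((xcol B s + e)%R k ord0)|%N.

(** The homogeneous form of [translation_rel], with [v None] as denominator. *)
Definition linear_family (R : nzRingType) (c : 'Z_q -> R)
    (v : option 'I_n -> R) :=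
  forall i j : 'I_n, v (Some j) = v (Some i) + c (l j.+1 - l i.+1) * v None.

Lemma loc_cleared B (e : 'cV[int]_n) s : (forall k, 0 <= (xcol B s + e) k ord0) ->
  loc (cleared B e s) = tmonomial l (xcol B s) * tmonomial l e.
Proof.
move=> e_ge; rewrite -tmonomialD /tmonomial rmorph_prod.
by apply: eq_bigr => k _; rewrite rmorphXn exprnP gez0_abs.
Qed.

Lemma rel_cleared B (e : 'cV[int]_n) : (forall s k, 0 <= (xcol B s + e) k ord0) ->
  translation_rel l B <-> linear_family (@polyC _) (cleared B e).
Proof.
move=> e_ge; have locE s := loc_cleared (e_ge s).
have locE0 : loc (cleared B e None) = tmonomial l e.
  by rewrite locE /= tmonomial0 mul1r.
split=> rB i j.
  apply: (@loc_inj d q l); rewrite rmorphD rmorphM /= locE0 !locE /= (rB i j).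
  by rewrite mulrDl.
have := congr1 loc (rB i j); rewrite rmorphD rmorphM /= locE0 !locE /= -mulrDl.
by apply: mulIr; apply: tmonomial_unit.
Qed.

(** Two members of the family determine the others, as differences of the
    [l i.+1] are units. *)
Lemma linear_family_eq0 (v : option 'I_n -> 'Z_q) s1 s2 :
    linear_family id v -> s1 != s2 -> v s1 = 0 -> v s2 = 0 ->
  forall s, v s = 0.
Proof.
move=> vlin s12 v1 v2.
have v0j i : v None = 0 -> v (Some i) = 0 -> forall s, v s = 0.
  by move=> v0 vi [j|//]; rewrite (vlin i j) vi v0 mulr0 addr0.
case: s1 s2 s12 v1 v2 => [i|] [j|] ij v1 v2 //; last first.
- exact: v0j v2.
- exact: v0j v1.
suff v0 : v None = 0 by apply: v0j v1.
have := vlin i j; rewrite v1 v2 add0r => /esym/eqP.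
rewrite mulrI_eq0 => [/eqP//|]; apply: mulrI; apply: l_unit.
by apply: contraNneq ij => ->.
Qed.

(** In the row of t + l_k all entries, that of the constant monomial included,
    are equal to the minimum [xcol B s k ord0] except at most one: after
    dividing by the minimal power of t + l_k, the members above the
    minimum vanish at - l_k while member [s] takes a unit value there. *)
Lemma row_sparse B k s s1 s2 : translation_rel l B -> s1 != s2 ->
    (forall s', xcol B s k ord0 <= xcol B s' k ord0) ->
  xcol B s1 k ord0 = xcol B s k ord0 \/ xcol B s2 k ord0 = xcol B s k ord0.
Proof.
move=> rB s12 s_min.
(* Exponent of the multiplier: it cancels the minimum in row k, and it is
   merely large enough in the other rows. *)
pose e : 'cV[int]_n := \col_k'
  if k' == k then - xcol B s k ord0 else (\sum_j `|B k' j|%N)%:Z.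
have eE s' : (xcol B s' + e) k ord0 = xcol B s' k ord0 - xcol B s k ord0.
  by rewrite !mxE eqxx.
have e_ge s' k' : 0 <= (xcol B s' + e) k' ord0.
  have [->|/negPf k'k] := eqVneq k' k; first by rewrite eE subr_ge0.
  have absD (z : int) (m : nat) : 0 <= z + (`|z| + m)%N by lia.
  rewrite !mxE k'k; case: s' => [j|] /=; last by rewrite mxE.
  by rewrite mxE (bigD1 j) //= absD.
have lin := (rel_cleared e_ge).1 rB.
pose v s' := (cleared B e s').[- l k.+1].
have vlin : linear_family id v.
  by move=> i j; rewrite /v (lin i j) !hornerE.
have vE s' : v s' = 0 ^+ `|xcol B s' k ord0 - xcol B s k ord0|%N *
    \prod_(k' < n | k' != k) (l k'.+1 - l k.+1) ^+ `|((xcol B s' + e)%R k' ord0)|%N.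
  rewrite /v /cleared horner_prod (bigD1 k) //= eE horner_exp.
  rewrite /tshift !hornerE addNr; congr (_ * _); apply: eq_bigr => k' _.
  by rewrite horner_exp !hornerE addrC.
have v_eq0 s' : xcol B s' k ord0 <> xcol B s k ord0 -> v s' = 0.
  move=> /eqP; rewrite -subr_eq0 -absz_eq0 vE expr0n => /negPf ->.
  by rewrite mul0r.
have vs : v s != 0.
  suff: v s \is a GRing.unit by apply: contraTneq => ->; rewrite unitr0.
  rewrite vE subrr expr0 mul1r; apply: rpred_prod => k' k'k.
  by rewrite rpredX ?l_unit.
have [|/eqP/v_eq0 v1] := eqVneq (xcol B s1 k ord0) (xcol B s k ord0); first by left.
have [|/eqP/v_eq0 v2] := eqVneq (xcol B s2 k ord0) (xcol B s k ord0); first by right.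
by rewrite (linear_family_eq0 vlin s12 v1 v2) eqxx in vs.
Qed.

(** The constant monomial has exponent 0: if 0 is the minimum then one entry
    at most is positive, otherwise the constant monomial is the exception and
    all the entries equal the minimum. *)
Lemma row_shape B k : translation_rel l B ->
  exists a (s : option 'I_n), 0 <= a /\
    forall j, B k j = a * (if s is Some i then (i == j)%:R else -1).
Proof.
move=> rB; pose c s := xcol B s k ord0.
have cE j : c (Some j) = B k j by rewrite /c /= mxE.
have c0 : c None = 0 by rewrite /c /= mxE.
have [s _ s_min] := @arg_minP _ _ _ None xpredT c isT.
have sp s1 s2 : s1 != s2 -> c s1 = c s \/ c s2 = c s.
  by move=> s12; apply: row_sparse => // s'; apply: s_min.
have [cs0|cs0] := eqVneq (c s) 0.
  have [[j Bj]|noj] := pselect (exists j, B k j <> 0).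
    exists (B k j), (Some j); split; first by rewrite -cE -cs0 s_min.
    move=> j'; have [<-|jj'] := eqVneq j j'; first by rewrite mulr1.
    have sjj' : Some j != Some j' by apply: contraNneq jj' => -[->].
    case: (sp _ _ sjj'); first by rewrite cE cs0.
    by rewrite cE cs0 mulr0.
  exists 0, None; split=> // j; rewrite mul0r.
  by apply: contrapT => Bj; apply: noj; exists j.
exists (- c s), None; split.
  by rewrite oppr_ge0 -c0 s_min.
move=> j; rewrite mulrNN mulr1 -cE; case: (sp None (Some j)) => // h.
by rewrite -h c0 eqxx in cs0.
Qed.

(** Row [k] times the [k]-th column of the inverse is 1, so the multiplier of
    the row divides 1; equal rows would give equal rows of the identity. *)
Lemma rel_row_form (B : 'M[int]_n) : B \in unitmx -> translation_rel l B ->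
  exists2 o, injective o & B = row_form o.
Proof.
move=> uB rB; have BV := mulmxV uB.
have /choice[o oE] k : exists s : option 'I_n,
    forall j, B k j = if s is Some i then (i == j)%:R else -1.
  have [a [s [a_ge0 Bk]]] := row_shape k rB; exists s.
  suff a1 : a = 1 by move=> j; rewrite Bk a1 mul1r.
  have := congr1 (fun M : 'M_n => M k k) BV; rewrite !mxE eqxx.
  under eq_bigr do rewrite Bk -mulrA.
  by rewrite -mulr_sumr; apply: int_mul_eq1.
exists o; last by apply/matrixP => k j; rewrite mxE.
move=> k k' kk'; have: row k B = row k' B.
  by apply/rowP => j; rewrite !mxE !oE kk'.
move/(congr1 (fun r => r *m invmx B)); rewrite -!row_mul BV => /rowP/(_ k).
rewrite !mxE eqxx; by case: eqVneq.
Qed.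

(** The numerators N_i, for [Some i], and the denominator D, for [None], of the
    monomials of [row_form o]. For an injective [o] each is a linear form or 1. *)
Definition form_poly (o : 'I_n -> option 'I_n) s : {poly 'Z_q} :=
  \prod_k X_ k ^+ (o k == s).

(** The common denominator D clears all the columns at once: it adds 1 exactly
    in the rows equal to (-1, ..., -1). *)
Lemma rel_form o :
  translation_rel l (row_form o) <-> linear_family (@polyC _) (form_poly o).
Proof.
pose e : 'cV[int]_n := \col_k (o k == None)%:R.
have eE s k : (xcol (row_form o) s + e) k ord0 = (o k == s)%:R.
  rewrite !mxE; case: s => [j|]; rewrite /= !mxE ?add0r //.
  by case: (o k) => [i|] /=; rewrite ?addNr ?addr0.
rewrite (@rel_cleared _ e) => [|s k]; last by rewrite eE; case: (_ == _).
have pE s : cleared (row_form o) e s = form_poly o s.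
  by apply: eq_bigr => k _; rewrite eE; case: (_ == _).
by split=> h i j; have := h i j; rewrite !pE.
Qed.

Lemma form_poly_hit o k s : injective o -> o k = s -> form_poly o s = X_ k.
Proof.
move=> oi <-; rewrite /form_poly (bigD1 k) //= eqxx expr1 big1 ?mulr1 // => k' k'k.
by rewrite (inj_eq oi) (negPf k'k) expr0.
Qed.

Lemma form_poly_miss o s : (forall k, o k <> s) -> form_poly o s = 1.
Proof. by move=> os; apply: big1 => k _; case: eqP (os k) => // _ _; rewrite expr0. Qed.

End Relation.

(** * Translations of the set of parameters *)

Section Translations.
Variables (d q : nat) (l : nat -> 'Z_q).
Hypothesis n_gt0 : (0 < d.-1)%N.
Hypothesis l1 : l 1%N = 0.
Hypothesis l_unit : forall i j : 'I_d.-1, i != j ->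
  l i.+1 - l j.+1 \is a GRing.unit.
Local Notation n := d.-1.
Local Notation X_ := (@tshift d q l).
Local Notation i0 := (Ordinal n_gt0).

Lemma shift_inj : injective (fun i : 'I_n => l i.+1).
Proof.
move=> i j /= lij; apply: contraTeq isT => /l_unit.
by rewrite lij subrr unitr0.
Qed.

(** When adding [c] preserves the set of parameters, this is the permutation
    matrix sending the basis vector of each parameter to that of its
    translate. *)
Definition trans_mx (c : 'Z_q) : 'M[int]_n :=
  \matrix_(i, j) (l i.+1 == l j.+1 + c)%:R.

Definition trans_stable (c : 'Z_q) :=
  forall j : 'I_n, exists k : 'I_n, l k.+1 = l j.+1 + c.

Lemma trans_mx0 : trans_mx 0 = 1%:M.
Proof. by apply/matrixP => i j; rewrite !mxE addr0 (inj_eq shift_inj). Qed.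

Lemma trans_mxM c c' : trans_stable c' ->
  trans_mx c *m trans_mx c' = trans_mx (c + c').
Proof.
move=> st; apply/matrixP => i j; rewrite !mxE; have [k lk] := st j.
rewrite (bigD1 k) //= big1 ?addr0 => [|k' k'k]; rewrite !mxE.
  by rewrite -lk eqxx mulr1 lk -addrA [c' + c]addrC.
by rewrite -lk (inj_eq shift_inj) (negPf k'k) mulr0.
Qed.

Lemma trans_mx_rel c : trans_stable c -> translation_rel l (trans_mx c).
Proof.
move=> st; have tE j : tmonomial l (col j (trans_mx c)) =
    to_loc (denoms_mulset d l) ('X + (l j.+1 + c)%:P).
  have [k lk] := st j; rewrite -lk /tmonomial (bigD1 k) //= big1 ?mulr1.
    by rewrite !mxE lk eqxx expr1z -lk.
  by move=> k' k'k; rewrite !mxE -lk (inj_eq shift_inj) (negPf k'k) expr0z.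
move=> i j; rewrite !tE -rmorphD; congr (to_loc _ _).
by rewrite !polyCD polyCN; ring.
Qed.

Lemma trans_mx_stab c : trans_stable c -> trans_stable (- c) ->
  ker_stab d l (trans_mx c).
Proof.
move=> st stN; apply: (@rel_ker_stab _ _ _ _ (trans_mx (- c))) => //.
- by rewrite trans_mxM // subrr trans_mx0.
- exact: trans_mx_rel.
- exact: trans_mx_rel.
Qed.

(** Here the denominator is 1: each m_j is a linear form, and the relation
    says that the parameter of m_j is l_j plus a constant. *)
Lemma form_trans o : injective o -> (forall k, o k <> None) ->
    translation_rel l (row_form o) ->
  exists2 c, trans_stable c & row_form o = trans_mx c.
Proof.
move=> oi o0 /rel_form lin; pose f k := odflt k (o k).
have oE k : o k = Some (f k) by rewrite /f; case: (o k) (o0 k).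
have fi : injective f by move=> k k' kk'; apply: oi; rewrite !oE kk'.
have [g fK gK] := injF_bij fi.
have pS j : form_poly l o (Some j) = X_ (g j).
  by apply: form_poly_hit; rewrite // oE gK.
have pN : form_poly l o None = 1 by apply: form_poly_miss.
have gE j : l (g j).+1 = l j.+1 + l (g i0).+1.
  have := lin i0 j; rewrite !pS pN mulr1 /= l1 subr0 /tshift -addrA => /addrI.
  by rewrite -polyCD => /polyC_inj ->; rewrite addrC.
exists (l (g i0).+1) => [j|]; first by exists (g j).
apply/matrixP => k j; rewrite !mxE oE -gE (inj_eq shift_inj).
by rewrite -[k == g j](inj_eq fi) gK.
Qed.

(** The denominator is t + l_k0, so some numerator N_i is 1. Every other
    numerator N_j is monic of degree 1 and equals
    1 + (l_j - l_i)(t + l_k0), so that l_j = l_i + 1: there is only one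
    such j. *)
Lemma form_none_small (o : 'I_n -> option 'I_n) k0 : injective o -> o k0 = None ->
  translation_rel l (row_form o) -> (n <= 2)%N.
Proof.
move=> oi ok0 /rel_form lin; rewrite leqNgt; apply/negP => n_gt2.
have [i oiN] : exists i, forall k, o k <> Some i.
  apply: contrapT => H; have {H} /choice[g gE] i : exists k, o k = Some i.
    by apply: contrapT => oiN; apply: H; exists i => k ok; apply: oiN; exists k.
  have gi : injective g by move=> j j' jj'; have := gE j; rewrite jj' gE => -[].
  by have [g' _ gK] := injF_bij gi; have := gE (g' k0); rewrite gK ok0.
have step j : j != i -> l j.+1 - l i.+1 = 1.
  move=> ji; have := lin i j.
  rewrite (form_poly_miss l oiN) (form_poly_hit l oi ok0).
  have [[k okj]|noj] := pselect (exists k, o k = Some j).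
    rewrite (form_poly_hit l oi okj) => /(congr1 (fun p : {poly _} => p`_1)).
    by rewrite /tshift !(coefD, coefX, coefC, coefCM) !addr0 mulr1 add0r.
  rewrite form_poly_miss => [|k ok]; last by apply: noj; exists k.
  move=> /(congr1 (fun p : {poly _} => p`_1)).
  rewrite /tshift !(coefD, coefX, coef1, coefC, coefCM) !addr0 mulr1 add0r.
  by move=> u0; have := l_unit ji; rewrite -u0 unitr0.
have [j ji [j' j'i jj']] : exists2 j, j != i & exists2 j', j' != i & j != j'.
  have : (1 < #|[set~ i]%SET|)%N by rewrite cardsC1 card_ord; lia.
  move=> /card_gt1P[j [j' [ji j'i jj']]].
  by exists j; [|exists j' => //]; rewrite !inE in ji j'i.
have := l_unit jj'; rewrite (_ : l j.+1 = l j'.+1) ?subrr ?unitr0 //.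
by apply: (addIr (- l i.+1)); rewrite !step.
Qed.

(** The parameter 0 is moved to [c], so [c] is a difference of two parameters,
    hence a unit, and its multiples exhaust 'Z_q. *)
Lemma trans_surj c : c != 0 -> trans_stable c ->
  forall x, exists k : 'I_n, l k.+1 = x.
Proof.
move=> c0 st x.
have uc : c \is a GRing.unit.
  have [k] := st i0; rewrite /= l1 add0r => lk.
  have := @l_unit k i0; rewrite /= l1 subr0 lk; apply.
  by apply: contraNneq c0 => ki; rewrite -lk ki /= l1.
have mul m : exists k : 'I_n, l k.+1 = c *+ m.
  elim: m => [|m [k lk]]; first by exists i0.
  by have [k' lk'] := st k; exists k'; rewrite lk' lk mulrSr.
have [k lk] := mul (x / c : 'Z_q); exists k.
by rewrite lk -mulr_natr natr_Zp mulrC divrK.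
Qed.

Lemma surj_card : (1 < q)%N -> (forall x, exists k : 'I_n, l k.+1 = x) -> q = n.
Proof.
move=> q_gt1 /choice[g gE].
have gi : injective g by move=> x y xy; rewrite -(gE x) xy gE.
apply/eqP; rewrite eqn_leq.
have := leq_card _ gi; rewrite !card_ord Zp_cast // => -> /=.
by have := leq_card _ shift_inj; rewrite !card_ord Zp_cast.
Qed.

Lemma ker_stab_classify B : ker_stab d l B ->
  (exists2 c, trans_stable c & B = trans_mx c) \/
  (n <= 2)%N /\ exists2 o : 'I_n -> option 'I_n, injective o &
     translation_rel l (row_form o) /\ B = row_form o.
Proof.
move=> KB; have rB := ker_stab_rel KB; case: KB => uB _.
have [o oi oB] := rel_row_form l_unit uB rB; rewrite oB in rB *.
have [[k ok]|oN] := pselect (exists k, o k = None).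
  by right; split; [exact: form_none_small oi ok rB | exists o].
by left; apply: form_trans => // k ok; apply: oN; exists k.
Qed.

End Translations.

(** * All residues as parameters *)

Lemma invmx_uniq n (B B' : 'M[int]_n) : B *m B' = 1%:M -> invmx B = B'.
Proof.
move=> BB'; have [uB _] := mulmx1_unit BB'.
by rewrite -[LHS]mulmx1 -BB' mulmxA mulVmx ?mul1mx.
Qed.

Section FullTranslations.
Variables (d : nat) (l : nat -> 'Z_d.-1).
Hypothesis d_gt3 : (3 < d)%N.
Hypothesis l1 : l 1%N = 0.
Hypothesis l_unit : forall i j : 'I_d.-1, i != j ->
  l i.+1 - l j.+1 \is a GRing.unit.

(** Here the parameters are as many as the elements of the ring, so every
    element is a parameter. *)
Lemma full_stable c : trans_stable d l c.
Proof.
move=> j; have [|g _ gK] := inj_card_bij (shift_inj l_unit).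
  by rewrite !card_ord Zp_cast //; lia.
by exists (g (l j.+1 + c)); rewrite gK.
Qed.

Lemma full_ker_stab : ker_stab d l = range (trans_mx d l).
Proof.
have n_gt0 : (0 < d.-1)%N by lia.
apply/seteqP; split=> [B KB|_ [c _ <-]]; last first.
  by apply: trans_mx_stab => //; apply: full_stable.
have [[c _ ->]|[n2 _]] := ker_stab_classify n_gt0 l1 l_unit KB; first by exists c.
by exfalso; lia.
Qed.

Lemma full_iso : mx_group_iso ('Z_(d.-1)) (ker_stab d l).
Proof.
exists (trans_mx d l); split; last by rewrite full_ker_stab.
  by move=> c c'; rewrite (trans_mxM l_unit) //; apply: full_stable.
move=> c c' cc'; have n_gt0 : (0 < d.-1)%N by lia.
have [k lk] := full_stable c (Ordinal n_gt0).
have := congr1 (fun M : 'M_ _ => M k (Ordinal n_gt0)) cc'.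
rewrite !mxE lk eqxx; case: eqP => // /addrI //.
Qed.

Lemma full_cycle :
    (forall i : nat, (1 <= i <= d.-1)%N -> l i = (i.-1)%:R) ->
  ker_stab d l = mx_cycle (cyclic_shift_mx d.-1).
Proof.
move=> lE; have n_gt1 : (1 < d.-1)%N by lia.
have lE' (i : 'I_d.-1) : l i.+1 = i%:R by rewrite lE //=; case: i => i /= hi; lia.
have natE (m m' : nat) : ((m%:R : 'Z_d.-1) == m'%:R) = (m == m' %[mod d.-1]).
  apply/eqP/eqP => [/(congr1 (@nat_of_ord _))|h]; first by rewrite !val_Zp_nat.
  by apply: ord_inj; rewrite !val_Zp_nat.
have -> : cyclic_shift_mx d.-1 = trans_mx d l 1.
  apply/matrixP => i j; rewrite !mxE !lE'; congr (_%:R); congr nat_of_bool.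
  rewrite -(natrD _ j 1) natE addn1 modn_small //.
  have [jn|jn] := eqVneq (j : nat) d.-2.
    rewrite jn andbT prednK; last by lia.
    rewrite modnn orb_idl // => /eqP ij; have := ltn_ord i; lia.
  rewrite andbF orbF modn_small //; have := ltn_ord j; lia.
have powE c k : trans_mx d l c ^+ k = trans_mx d l (c *+ k).
  elim: k => [|k IHk]; first by rewrite mulr0n (trans_mx0 l_unit).
  by rewrite exprS IHk mulrS -(trans_mxM l_unit) //; apply: full_stable.
have invE : invmx (trans_mx d l 1) = trans_mx d l (-1).
  apply: invmx_uniq; rewrite (trans_mxM l_unit) ?subrr ?(trans_mx0 l_unit) //.
  exact: full_stable.
rewrite full_ker_stab; apply/seteqP; split=> [_ [c _ <-]|C [k]].
  by exists c; left; rewrite powE natr_Zp.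
by rewrite invE !powE => -[] ->; [exists (1 *+ k)|exists (-1 *+ k)].
Qed.

End FullTranslations.

(** * Two parameters *)

Lemma ord2P (i : 'I_2) : i = ord0 \/ i = ord_max.
Proof. by case: i => [[|[|//]] hi]; [left|right]; apply: val_inj. Qed.

Section Rank2.
Variables (q : nat) (l : nat -> 'Z_q).
Hypothesis l1 : l 1%N = 0.
Hypothesis l_unit : forall i j : 'I_2, i != j ->
  l i.+1 - l j.+1 \is a GRing.unit.
Local Notation a := (l 2%N).
Local Notation K := (ker_stab 3 l).

Definition form2 (s t : option 'I_2) (k : 'I_2) := if k == ord0 then s else t.

Local Notation S0 := (Some (ord0 : 'I_2)).
Local Notation S1 := (Some (ord_max : 'I_2)).

Lemma form2_surj (o : 'I_2 -> option 'I_2) : o = form2 (o ord0) (o ord_max).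
Proof. by apply/funext => k; rewrite /form2; case: (ord2P k) => ->. Qed.

Definition fpoly2 (s t u : option 'I_2) : {poly 'Z_q} :=
  'X ^+ (s == u) * ('X + a%:P) ^+ (t == u).

(** The parameters are 0 and [l 2], so only the equation between the two
    numerators is left. *)
Lemma rel2 s t : translation_rel (d := 3) l (row_form (form2 s t)) <->
  fpoly2 s t S1 = fpoly2 s t S0 + a%:P * fpoly2 s t None.
Proof.
rewrite rel_form; have pE u : form_poly (d := 3) l (form2 s t) u = fpoly2 s t u.
  rewrite /form_poly big_ord_recl big_ord1 /tshift /form2 /fpoly2 /=.
  by rewrite l1 addr0.
split=> [/(_ ord0 ord_max)|h i j]; first by rewrite !pE /= l1 subr0.
case: (ord2P i) => ->; case: (ord2P j) => ->; rewrite !pE /= ?subrr ?mul0r ?addr0 //.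
  by rewrite l1 subr0.
by rewrite l1 sub0r h polyCN mulNr addrK.
Qed.

(** For s <> t the two sides are affine polynomials, so the values at 0 and 1 carry
    all that the equation says about the parameter. *)
Lemma rel2_at s t (x : 'Z_q) :
    translation_rel (d := 3) l (row_form (form2 s t)) ->
  let v u := x ^+ (s == u) * (x + a) ^+ (t == u) in
  v S1 = v S0 + a * v None.
Proof.
have vE u : (fpoly2 s t u).[x] = x ^+ (s == u) * (x + a) ^+ (t == u).
  by rewrite /fpoly2 !hornerE.
by move=> /rel2 h /=; rewrite -!vE h hornerD hornerCM.
Qed.

Local Notation mA := (mx_of_rows 2 [:: [:: 1; 0]; [:: -1; -1]]).
Local Notation mB := (mx_of_rows 2 [:: [:: -1; -1]; [:: 0; 1]]).
Local Notation mC := (mx_of_rows 2 [:: [:: -1; -1]; [:: 1; 0]]).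
Local Notation mD := (mx_of_rows 2 [:: [:: 0; 1]; [:: -1; -1]]).
Local Notation mE := (mx_of_rows 2 [:: [:: 0; 1]; [:: 1; 0]]).

Lemma form2_mx :
  [/\ row_form (form2 S0 S1) = 1%:M,
      row_form (form2 S0 None) = mA /\ row_form (form2 None S1) = mB,
      row_form (form2 None S0) = mC /\ row_form (form2 S1 None) = mD
    & row_form (form2 S1 S0) = mE].
Proof.
by do !split; apply/matrixP => i j; rewrite !mxE /form2;
  case: (ord2P i) => ->; case: (ord2P j) => ->.
Qed.

Lemma rank2_inv : [/\ mA *m mA = 1%:M /\ mB *m mB = 1%:M,
  mC *m mD = 1%:M, mD *m mC = 1%:M & mE *m mE = 1%:M].
Proof.
by do !split; apply/matrixP => i j; rewrite !mxE !big_ord_recr big_ord0 /= !mxE;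
  case: (ord2P i) => ->; case: (ord2P j) => ->.
Qed.

Lemma rank2_sub B : K B ->
  [\/ B = 1%:M, B = mA /\ a = -1, B = mB /\ a = 1
    | B \in [:: mC; mD; mE] /\ 2%:R = 0 :> 'Z_q].
Proof.
move=> KB; have rB := ker_stab_rel KB; case: KB => uB _.
have [o oi oB] := rel_row_form (d := 3) l_unit uB rB.
have := @oi ord0 ord_max; rewrite oB in rB *; clear oi oB uB B.
rewrite (form2_surj o) in rB *; move: (o ord0) (o ord_max) rB => s t rB.
rewrite /form2 /= => st; have := rel2_at 0 rB; have := rel2_at 1 rB.
have [f1 [fA fB] [fC fD] fE] := form2_mx; rewrite -/(form2 s t).
have ua : a \is a GRing.unit.
  by have := @l_unit ord_max ord0 isT; rewrite /= l1 subr0.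
(* This is the equation at t = 1 when the denominator is t + a. *)
have aE : 1 = 1 + a * (1 + a) -> a = -1.
  move=> h; have h0 : a * (1 + a) = 0 by apply: (addrI 1); rewrite addr0 -h.
  apply: (mulrI ua); have -> : a * a = a * (1 + a) + a * -1 by ring.
  by rewrite h0 add0r.
case: s t st {rB} => [s|] [t|] st /=; last by have := st erefl.
- case: (ord2P s) (ord2P t) st => -> [] -> st; try by have := st erefl.
    by move=> _ _; apply: Or41.
  rewrite /= !expr0 !expr1 !mul1r mulr1 mul0r add0r => _ r0.
  apply: Or44; rewrite fE !inE eqxx !orbT; split=> //.
  by apply: (mulrI ua); rewrite mulr0 r0; ring.
- case: (ord2P s) => -> /=; rewrite !expr0 !expr1 !mul1r ?mul0r ?mulr1 !add0r.
    by move=> /aE a1 _; apply: Or42; rewrite fA.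
  move=> /aE -> ; rewrite mulrNN mulr1 => r0.
  by apply: Or44; rewrite fD !inE eqxx !orbT; split=> //; rewrite r0.
case: (ord2P t) => -> /=; rewrite !expr0 !expr1 !mul1r !mulr1 !add0r mulr0 addr0.
  move=> r1 r0; apply: Or44; rewrite fC !inE eqxx; split=> //.
  rewrite -r0 in r1; apply: (addrI 1); rewrite addr0 [RHS]r1; ring.
by move=> _ r0; apply: Or43; rewrite fB.
Qed.

Lemma rank2_super : [/\ K 1%:M, (a = -1 -> K mA), (a = 1 -> K mB)
  & a = 1 -> 2%:R = 0 :> 'Z_q -> [/\ K mC, K mD & K mE]].
Proof.
have [f1 [fA fB] [fC fD] fE] := form2_mx.
have [[iA iB] iC iD iE] := rank2_inv.
have r1 : translation_rel (d := 3) l 1%:M.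
  by rewrite -f1 rel2 /fpoly2 /= !expr0 !expr1; ring.
split.
- by apply: (@rel_ker_stab 3 q l _ 1%:M); rewrite ?mulmx1.
- move=> aE; apply: (@rel_ker_stab 3 q l _ mA) => //; rewrite -fA rel2 /fpoly2 /=;
  by rewrite !expr0 !expr1 aE polyCN; ring.
- move=> aE; apply: (@rel_ker_stab 3 q l _ mB) => //; rewrite -fB rel2 /fpoly2 /=;
  by rewrite !expr0 !expr1 aE; ring.
move=> aE two0.
have two0P : 2%:R = 0 :> {poly 'Z_q} by rewrite -polyC_natr two0.
have rC : translation_rel (d := 3) l mC.
  rewrite -fC rel2 /fpoly2 /= !expr0 !expr1 aE.
  by apply: subr0_eq; rewrite -(mulr0 (- 'X)) -two0P; ring.
have rD : translation_rel (d := 3) l mD.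
  rewrite -fD rel2 /fpoly2 /= !expr0 !expr1 aE.
  by apply: subr0_eq; rewrite -(mulr0 (-1)) -two0P; ring.
have rE : translation_rel (d := 3) l mE.
  rewrite -fE rel2 /fpoly2 /= !expr0 !expr1 aE.
  by apply: subr0_eq; rewrite -(mulr0 (-1)) -two0P; ring.
by split; [apply: (@rel_ker_stab 3 q l _ mD) | apply: (@rel_ker_stab 3 q l _ mC)
  | apply: (@rel_ker_stab 3 q l _ mE)].
Qed.
End Rank2.

(** * Groups of matrices *)

Lemma mx_cycle_involution n (M : 'M[int]_n) : M *m M = 1%:M ->
  mx_cycle M = [set C | C = 1%:M \/ C = M].
Proof.
move=> MM; have ME k : M ^+ k = if odd k then M else 1%:M.
  by elim: k => // k IHk; rewrite exprS IHk /=; case: (odd k) => /=;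
    [exact: MM | exact: mulmx1].
apply/seteqP; split=> C /=.
  by move=> [k]; rewrite (invmx_uniq MM) ME; case: (odd k) => -[] ->; auto.
by move=> [->|->]; [exists 0%N | exists 1%N]; left; rewrite ME.
Qed.

Lemma mx_group_iso_involution n (M : 'M[int]_n) : M *m M = 1%:M -> M <> 1%:M ->
  mx_group_iso 'Z_2 [set C | C = 1%:M \/ C = M].
Proof.
move=> MM M1; exists (fun c : 'Z_2 => if c == 0 then 1%:M else M); split.
- by move=> x y; case: (ord2P x) => ->; case: (ord2P y) => -> /=;
    rewrite ?mul1mx ?mulmx1 ?MM.
- move=> x y; case: (ord2P x) => ->; case: (ord2P y) => -> //= h; case: M1;
  by rewrite h.
apply/seteqP; split=> C /=; first by move=> [c _ <-]; case: ifP; auto.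
by move=> [->|->]; [exists 0 | exists 1].
Qed.

Lemma ord3P (i : 'I_3) : [\/ i = ord0, i = inord 1 | i = ord_max].
Proof.
by case: i => [[|[|[|//]]] hi]; [apply: Or31|apply: Or32|apply: Or33];
  apply: val_inj; rewrite //= inordK.
Qed.

(** Two distinct transpositions are involutions whose product has order 3, so
    they generate the whole group; a group generated by two involutions is
    dihedral. *)
Lemma S3_isog_D6 : ([set: 'S_3]%SET \isog [set: 'D_6]%SET)%g.
Proof.
pose x : 'S_3 := tperm ord0 (inord 1); pose y : 'S_3 := tperm (inord 1) ord_max.
have n01 : ord0 != inord 1 :> 'I_3 by rewrite -val_eqE /= inordK.
have n12 : inord 1 != ord_max :> 'I_3 by rewrite -val_eqE /= inordK.
have n02 : ord0 != ord_max :> 'I_3 by [].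
have [n10 n21 n20] : [/\ inord 1 != ord0 :> 'I_3, ord_max != inord 1 :> 'I_3
    & ord_max != ord0 :> 'I_3] by split; rewrite eq_sym.
have neq_at (s t : 'S_3) i : s i != t i -> s != t by apply: contraNneq => ->.
have ox : #[x]%g = 2%N.
  apply: nt_prime_order; rewrite ?expgS ?expg0 ?mulg1 ?tperm2 //.
  by apply: (@neq_at _ _ ord0); rewrite perm1 tpermL.
have oy : #[y]%g = 2%N.
  apply: nt_prime_order; rewrite ?expgS ?expg0 ?mulg1 ?tperm2 //.
  by apply: (@neq_at _ _ ord_max); rewrite perm1 tpermR.
have oxy : #[(x * y)%g]%g = 3%N.
  apply: nt_prime_order => //; last first.
    by apply: (@neq_at _ _ ord0); rewrite perm1 permM tpermL tpermL.
  apply/permP => i; rewrite !expgS expg0 mulg1 perm1 !permM.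
  have xE : (x ord0 = inord 1) * (x (inord 1) = ord0) * (x ord_max = ord_max).
    by rewrite tpermL tpermR tpermD.
  have yE : (y ord0 = ord0) * (y (inord 1) = ord_max) * (y ord_max = inord 1).
    by rewrite tpermL tpermR tpermD.
  by case: (ord3P i) => ->; rewrite !(xE, yE).
have xy : x != y by apply: (@neq_at _ _ ord0); rewrite tpermL tpermD.
have := involutions_gen_dihedral ox oy xy; set G := <<_>>%g => isoG.
have Gx : x \in G by rewrite mem_gen // !inE eqxx.
have Gy : y \in G by rewrite mem_gen // !inE eqxx orbT.
have cT : #|[set: 'S_3]%SET| = 6%N by rewrite cardsT card_Sn.
have cG : #|G| = 6%N.
  have le6 : (#|G| <= 6)%N by rewrite -cT subset_leq_card ?finset.subsetT.
  have dv : (6 %| #|G|)%N.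
    have dx := order_dvdG Gx; have dxy := order_dvdG (groupM Gx Gy).
    by rewrite ox in dx; rewrite oxy in dxy; rewrite (@Gauss_dvd 2 3) // dx dxy.
  by apply/eqP; rewrite eqn_leq le6 dvdn_leq ?cardG_gt0.
have -> : [set: 'S_3]%SET = G.
  by apply/esym/eqP; rewrite eqEcard finset.subsetT cT cG.
by rewrite cG in isoG.
Qed.

(** Three vectors of sum 0, any two of which form a basis of Z^2. *)
Definition simplex_row (i : 'I_3) : 'rV[int]_2 :=
  \row_j (if i == ord_max then -1 else (i == j :> nat)%:R).

(** The action of 'S_3 on the three vectors, in the basis of the first two. *)
Definition simplex_rep (s : 'S_3) : 'M[int]_2 :=
  \matrix_(k, j) simplex_row (s (widen_ord (leqnSn 2) k)) 0 j.

Lemma simplex_row_inj : injective simplex_row.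
Proof.
by move=> i i' /rowP h; have := h ord0; have := h ord_max; rewrite !mxE;
  case: (ord3P i) => ->; case: (ord3P i') => ->; rewrite -?val_eqE /= ?inordK.
Qed.

(** On the third vector this holds because the three vectors have sum 0, before
    and after the permutation. *)
Lemma simplex_repE s i : simplex_row i *m simplex_rep s = simplex_row (s i).
Proof.
have rowE k : row k (simplex_rep s) = simplex_row (s (widen_ord (leqnSn 2) k)).
  by apply/rowP => j; rewrite !mxE.
have sum0 : \sum_i simplex_row (s i) = 0.
  rewrite (reindex_inj (@perm_inj _ s^-1%g)) /=.
  under eq_bigr do rewrite permKV.
  apply/rowP => j; rewrite summxE !mxE !big_ord_recr big_ord0 /= !mxE.
  by case: (ord2P j) => ->.
have sum0' : simplex_row (s ord_max) =
    - simplex_row (s (widen_ord (leqnSn 2) ord0)) -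
      simplex_row (s (widen_ord (leqnSn 2) ord_max)).
  move: sum0; rewrite !big_ord_recr big_ord0 /= add0r => /eqP.
  rewrite addrC addr_eq0 => /eqP ->; rewrite opprD.
  by congr (- simplex_row (s _) - simplex_row (s _)); apply: val_inj.
rewrite mulmx_sum_row !big_ord_recr big_ord0 /= add0r !rowE !mxE.
case: (ord3P i) => ->; rewrite -?val_eqE /= ?inordK //= ?scale0r ?scale1r.
- by rewrite addr0; congr (simplex_row (s _)); apply: val_inj.
- by rewrite add0r; congr (simplex_row (s _)); apply: val_inj; rewrite /= inordK.
rewrite sum0' !scaleN1r; congr (- simplex_row (s _) - _); exact: val_inj.
Qed.

Lemma simplex_repM s t :
  simplex_rep (s * t)%g = simplex_rep s *m simplex_rep t.
Proof.
apply/row_matrixP => k; rewrite row_mul.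
have rowE u : row k (simplex_rep u) = simplex_row (u (widen_ord (leqnSn 2) k)).
  by apply/rowP => j; rewrite !mxE.
by rewrite !rowE simplex_repE permM.
Qed.

Lemma simplex_rep_inj : injective simplex_rep.
Proof.
move=> s t st; apply/permP => i; apply: simplex_row_inj.
by rewrite -!simplex_repE st.
Qed.

(** The six matrices are those with two distinct rows among the three vectors,
    so they are the images of the six permutations of these vectors. *)
Lemma mx_group_iso_D6 (P : set 'M[int]_2) : P = [set M | M \in
     [:: 1%:M; mx_of_rows 2 [:: [:: 1; 0]; [:: -1; -1]];
         mx_of_rows 2 [:: [:: -1; -1]; [:: 0; 1]];
         mx_of_rows 2 [:: [:: -1; -1]; [:: 1; 0]];
         mx_of_rows 2 [:: [:: 0; 1]; [:: -1; -1]];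
         mx_of_rows 2 [:: [:: 0; 1]; [:: 1; 0]]]] -> mx_group_iso 'D_6 P.
Proof.
set s := [:: _; _; _; _; _; _] => ->.
have rep_s t : simplex_rep t \in s.
  have tw : t (widen_ord (leqnSn 2) ord0) <> t (widen_ord (leqnSn 2) ord_max).
    by move=> /perm_inj /(congr1 val).
  have : simplex_rep t = \matrix_(k, j) simplex_row
     (if k == ord0 then t (widen_ord (leqnSn 2) ord0)
      else t (widen_ord (leqnSn 2) ord_max)) 0 j.
    by apply/matrixP => k j; rewrite !mxE; case: (ord2P k) => ->.
  move=> ->; move: (t (widen_ord _ ord0)) (t (widen_ord _ ord_max)) tw => x y xy.
  have mem i : (i < 6)%N -> (forall k j : 'I_2,
        simplex_row (if k == ord0 then x else y) 0 j = nth 0 s i k j) ->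
      \matrix_(k, j) simplex_row (if k == ord0 then x else y) 0 j \in s.
    move=> i6 h; rewrite (_ : \matrix_(_, _) _ = nth 0 s i) ?mem_nth //.
    by apply/matrixP => k j; rewrite mxE h.
  have ent i : (i < 6)%N -> [/\ simplex_row x 0 ord0 = nth 0 s i ord0 ord0,
      simplex_row x 0 ord_max = nth 0 s i ord0 ord_max,
      simplex_row y 0 ord0 = nth 0 s i ord_max ord0
    & simplex_row y 0 ord_max = nth 0 s i ord_max ord_max] ->
    \matrix_(k, j) simplex_row (if k == ord0 then x else y) 0 j \in s.
    move=> i6 [h1 h2 h3 h4]; apply: (mem i) => // k j.
    by case: (ord2P k) => ->; case: (ord2P j) => ->.
  (* The argument of [ent] is the position of the matrix in the list [s]. *)
  case: (ord3P x) (ord3P y) xy ent {mem} => -> [] -> // _ ent.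
  - by apply: (ent 0%N) => //; split; rewrite !mxE -?val_eqE /= ?inordK.
  - by apply: (ent 1%N) => //; split; rewrite !mxE -?val_eqE /= ?inordK.
  - by apply: (ent 5%N) => //; split; rewrite !mxE -?val_eqE /= ?inordK.
  - by apply: (ent 4%N) => //; split; rewrite !mxE -?val_eqE /= ?inordK.
  - by apply: (ent 3%N) => //; split; rewrite !mxE -?val_eqE /= ?inordK.
  - by apply: (ent 2%N) => //; split; rewrite !mxE -?val_eqE /= ?inordK.
have /isogP[g gi gT] : ([set: 'D_6]%SET \isog [set: 'S_3]%SET)%g.
  by rewrite isog_sym S3_isog_D6.
have img : forall t, exists x, g x = t.
  move=> t; have : t \in (g @* [set: 'D_6]%SET)%g by rewrite gT inE.
  by case/morphimP => x _ _ ->; exists x.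
exists (fun x => simplex_rep (g x)); split.
- by move=> x y; rewrite morphM ?inE // simplex_repM.
- by move=> x y /simplex_rep_inj h; apply: (injmP gi); rewrite ?inE.
apply/seteqP; split=> M /=; first by move=> [x _ <-]; apply: rep_s.
have [_ E] : (size [seq simplex_rep t | t : 'S_3] = size s) *
    ([seq simplex_rep t | t : 'S_3] =i s).
  apply: uniq_min_size.
  - by rewrite map_inj_uniq ?enum_uniq //; apply: simplex_rep_inj.
  - by move=> _ /mapP[t _ ->]; apply: rep_s.
  by rewrite size_map -cardE card_Sn.
rewrite -E => /mapP[t _ ->]; have [x <-] := img t; by exists x.
Qed.

(** * The classification *)

Lemma Zq_two0 q : (1 < q)%N -> 2%:R = 0 :> 'Z_q -> q = 2%N.
Proof.
move=> q_gt1 two0; have : (q %| 2)%N.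
  by rewrite /dvdn -(val_Zp_nat q_gt1) two0.
by move/dvdn_leq => /(_ isT) q_le2; apply/eqP; rewrite eqn_leq q_le2.
Qed.

Theorem theorem3p4 (d q : nat) (l : nat -> 'Z_q)
    (hd : (3 <= d)%N) (hq : (2 <= q)%N)
    (hdq : forall p : nat, prime p -> (p %| q)%N -> (d <= p.+1)%N)
    (hl1 : l 1%N = 0)
    (hl : forall i j : nat, (1 <= i <= d.-1)%N -> (1 <= j <= d.-1)%N ->
       i != j -> l i - l j \is a GRing.unit) :
  let K := ker_stab d l in
  let n := d.-1 in
  let A := mx_of_rows n [:: [:: 1; 0]; [:: -1; -1]] in
  let B := mx_of_rows n [:: [:: -1; -1]; [:: 0; 1]] in
  let C := mx_of_rows n [:: [:: -1; -1]; [:: 1; 0]] in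
  let D := mx_of_rows n [:: [:: 0; 1]; [:: -1; -1]] in
  let E := mx_of_rows n [:: [:: 0; 1]; [:: 1; 0]] in
  let case1 := (3 < d)%N /\ (q = d.-1 /\ prime q) in
  let case2 := d = 3%N /\ ((2 < q)%N /\ (l 2%N = 1 \/ l 2%N = -1)) in
  let case3 := d = 3%N /\ q = 2%N in
  [/\ case1 -> mx_group_iso 'Z_(d.-1) K /\
        ((forall i : nat, (1 <= i <= d.-1)%N -> l i = (i.-1)%:R) ->
         K = mx_cycle (cyclic_shift_mx n)),
      case2 -> [/\ mx_group_iso 'Z_2 K,
                   l 2%N = -1 -> K = mx_cycle A
                 & l 2%N = 1 -> K = mx_cycle B],
      case3 -> mx_group_iso 'D_6 K /\
               K = [set M | M \in [:: 1%:M; A; B; C; D; E]]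
    & ~ (case1 \/ case2 \/ case3) -> K = [set 1%:M]].
Proof.
have l_unit (i j : 'I_d.-1) : i != j -> l i.+1 - l j.+1 \is a GRing.unit.
  by move=> ij; apply: hl; rewrite /= ?ltn_ord // eqSS.
have n_gt0 : (0 < d.-1)%N by lia.
move=> K n A B C D E case1 case2 case3; split.
- case=> d_gt3 [qE _]; rewrite /K /n; clear -d_gt3 qE hl1 l_unit.
  subst q; split; first exact: full_iso.
  exact: full_cycle.
- case=> dE [q_gt2 l2E]; rewrite /K /A /B /n; clear -dE q_gt2 l2E hl1 l_unit.
  subst d; have [K1 KA KB _] := rank2_super hl1.
  have two0 : 2%:R <> 0 :> 'Z_q.
    by move=> /(Zq_two0 (ltnW q_gt2)) q2; rewrite q2 in q_gt2.
  have N1 : 1 <> -1 :> 'Z_q by move=> h; apply: two0; rewrite mulr2n {2}h subrr.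
  have [[iA iB] _ _ _] := rank2_inv.
  have neq1 (M : 'M[int]_2) i j : M i j <> (1%:M : 'M_2) i j -> M <> 1%:M.
    by move=> Mij M1; rewrite M1 in Mij.
  have An1 : mx_of_rows 2 [:: [:: 1; 0]; [:: -1; -1]] <> 1%:M.
    by apply: (neq1 _ ord_max ord_max); rewrite !mxE.
  have Bn1 : mx_of_rows 2 [:: [:: -1; -1]; [:: 0; 1]] <> 1%:M.
    by apply: (neq1 _ ord0 ord0); rewrite !mxE.
  have KAE : l 2%N = -1 -> ker_stab 3 l =
      [set M | M = 1%:M \/ M = mx_of_rows 2 [:: [:: 1; 0]; [:: -1; -1]]].
    move=> lN; apply/seteqP; split=> M /=; last first.
      by move=> [->|->]; [exact: K1 | exact: KA].
    move=> /(rank2_sub hl1 l_unit)[|[]|[_ lP]|[_ /two0]] //; auto.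
    by case: N1; rewrite -[LHS]lP lN.
  have KBE : l 2%N = 1 -> ker_stab 3 l =
      [set M | M = 1%:M \/ M = mx_of_rows 2 [:: [:: -1; -1]; [:: 0; 1]]].
    move=> lP; apply/seteqP; split=> M /=; last first.
      by move=> [->|->]; [exact: K1 | exact: KB].
    move=> /(rank2_sub hl1 l_unit)[|[_ lN]|[]|[_ /two0]] //; auto.
    by case: N1; rewrite -[LHS]lP lN.
  split.
  + case: l2E => [/KBE|/KAE] ->.
      exact: (mx_group_iso_involution iB Bn1).
    exact: (mx_group_iso_involution iA An1).
  + by move=> /KAE ->; rewrite mx_cycle_involution.
  + by move=> /KBE ->; rewrite mx_cycle_involution.
- case=> dE qE; rewrite /K /A /B /C /D /E /n; clear -dE qE hl1 l_unit.
  subst d q; have [K1 KA KB KC] := rank2_super hl1.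
  have two0 : 2%:R = 0 :> 'Z_2 by apply: val_inj.
  have l2 : l 2%N = 1.
    have : l 2%N != 0.
      have := @l_unit ord_max ord0 isT; rewrite /= hl1 subr0.
      by apply: contraTneq => ->; rewrite unitr0.
    by case: (ord2P (l 2%N)) => -> // _; apply: val_inj.
  have l2N : l 2%N = -1 by rewrite l2; apply: val_inj.
  have [KC' KD KE] := KC l2 two0.
  match goal with |- _ /\ ?X => suff KE6 : X by split; [exact: (mx_group_iso_D6 KE6)|exact: KE6] end.
  apply/seteqP; split=> M /=.
    move=> /(rank2_sub hl1 l_unit)[->|[-> _]|[-> _]|[]]; rewrite !inE ?eqxx ?orbT //.
    by move=> + _; case/or3P => ->; rewrite ?orbT.
  rewrite !inE; do 5?case/orP; move=> /eqP ->;
    [exact: K1|exact: KA l2N|exact: KB l2|exact: KC'|exact: KD|exact: KE].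
move=> ncase; apply/seteqP; split=> [M KM|_ ->] /=; last first.
  rewrite /K -(trans_mx0 l_unit).
  by apply: trans_mx_stab; rewrite ?oppr0 // => j; exists j; rewrite addr0.
have [d_gt3|d_le3] := ltnP 3 d.
  have [[c st ->]|[n2 _]] := ker_stab_classify n_gt0 hl1 l_unit KM; last by exfalso; lia.
  have [->|c0] := eqVneq c 0; first exact: trans_mx0.
  have qE := surj_card l_unit hq (trans_surj n_gt0 hl1 l_unit c0 st).
  case: ncase; left; split=> //; split=> //.
  have pp := pdiv_prime hq; have := hdq _ pp (pdiv_dvd q).
  have := dvdn_leq (ltnW hq) (pdiv_dvd q) => le1 le2.
  by rewrite (_ : q = pdiv q) //; lia.
have dE : d = 3%N by lia.
have [qE|q2] := eqVneq q 2%N; first by case: ncase; right; right.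
have q_gt2 : (2 < q)%N by rewrite ltn_neqAle eq_sym q2.
have {}ncase : ~ (l 2%N = 1 \/ l 2%N = -1) by move=> h; apply: ncase; right; left.
move: M KM; rewrite /K; clear -dE q_gt2 hl1 l_unit ncase hq; subst d => M KM.
have [//|[_ h]|[_ h]|[_ /(Zq_two0 hq) q2]] := rank2_sub hl1 l_unit KM.
- by case: ncase; right.
- by case: ncase; left.
by rewrite q2 in q_gt2.
Qed.
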